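(* Let $G$ be a simple graph. If $G$ is $\ell$-resilient, then $G$ does not have an edge-cut $C$ such that the edges of $C$ induce a subgraph of a complete bipartite graph $K_{a,b}$ with $a+b\le \ell$.
   Context: An edge-cut of $G$ is a set of edges of the form $C=\{uv\in E(G): u\in S,\ v\in V(G)\setminus S\}$ for some nonempty proper subset $S\subset V(G)$. The edges of $C$ induce the graph whose edge set is $C$ and whose vertex set is the set of endpoints of edges in $C$. Zero forcing color change rule: a blue vertex $u$ may force (color blue) a white vertex $v$ if $v$ is the only white neighbor of $u$. A leak is a vertex that is not allowed to perform a force. A set $B\subseteq V(G)$ is an $\ell$-leaky forcing set of $G$ if, whenever any $\ell$ vertices of $G$ are chosen to be leaks (after $B$ has been specified), starting with exactly $B$ blue (all others white) and iteratively applying the color change rule, with leaks not allowed to force, eventually colors all of $V(G)$ blue. $\mathrm{Z}_{(\ell)}(G)$ is the minimum size of an $\ell$-leaky forcing set of $G$. The graph $G$ is $\ell$-resilient if $\mathrm{Z}_{(0)}(G)=\mathrm{Z}_{(\ell)}(G)$.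
   Formalization: The edge-cut C is assumed nonempty; if an empty edge-cut of a disconnected graph were allowed, the claim would fail, e.g. for two isolated vertices and ℓ = 2. *)

(* Defs.v *)
From mathcomp Require Import all_boot.

Set Implicit Arguments.
Unset Strict Implicit.
Unset Printing Implicit Defensive.

Record sgraph := SGraph {
  vertex :> finType;
  adj : rel vertex;
  adj_sym : symmetric adj;
  adj_irrefl : irreflexive adj
}.

(* [H] is isomorphic to a subgraph of [K]. *)
Definition subgraph (H K : sgraph) : Prop :=
  exists f : H -> K,
    injective f /\ forall x y : H, adj x y -> adj (f x) (f y).

Section CompleteBipartite.

Variables a b : nat.

Definition cb_adj : rel ('I_a + 'I_b)%type :=
  fun x y => match x, y with
             | inl _, inr _ | inr _, inl _ => true
             | _, _ => false
             end.

Fact cb_adj_sym : symmetric cb_adj.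
Proof. by case=> ? [?|?]. Qed.

Fact cb_adj_irrefl : irreflexive cb_adj.
Proof. by case. Qed.

Definition complete_bipartite : sgraph := SGraph cb_adj_sym cb_adj_irrefl.

End CompleteBipartite.

Section Cuts.

Variable G : sgraph.

(* An edge {u, v} is represented by the two-element set [set u; v]. *)
Definition is_edge_cut (C : {set {set G}}) : Prop :=
  exists S : {set G},
    [/\ S != set0,
        S \proper [set: G]
      & C = [set [set u; v] | u in S, v in ~: S & adj u v]].

Variable C : {set {set G}}.

Definition edge_induced_adj : rel {x : G | x \in cover C} :=
  fun x y => (val x != val y) && ([set val x; val y] \in C).

Fact edge_induced_adj_sym : symmetric edge_induced_adj.
Proof. by move=> x y; rewrite /edge_induced_adj eq_sym setUC. Qed.

Fact edge_induced_adj_irrefl : irreflexive edge_induced_adj.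
Proof. by move=> x; rewrite /edge_induced_adj eqxx. Qed.

Definition edge_induced : sgraph :=
  SGraph edge_induced_adj_sym edge_induced_adj_irrefl.

End Cuts.

Section LeakyForcing.

Variable G : sgraph.
Implicit Types (L X Y B : {set G}) (u v w : G) (l : nat).

(* [X] is the set of blue vertices and [L] the set of leaks. *)
Definition can_force L X u v : bool :=
  [&& u \in X, u \notin L, v \notin X, adj u v
    & [forall w, adj u w && (w \notin X) ==> (w == v)]].

Definition color_change L : rel {set G} :=
  fun X Y => [exists u, exists v, can_force L X u v && (Y == v |: X)].

(* The color change rule is applied one force at a time; the final coloring
   does not depend on the order of the forces, so that reaching [set: G] by
   some sequence of forces is the same as reaching it by every maximal one. *)
Definition leaky_forcing l B : bool :=
  [forall L : {set G}, (#|L| == l) ==> connect (color_change L) B [set: G]].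

(* Ensures that the minimum below is taken over a nonempty family. *)
Fact leaky_forcing_setT l : leaky_forcing l [set: G].
Proof. by apply/forallP => L; rewrite connect0 implybT. Qed.

Definition leaky_forcing_number l : nat :=
  #|[arg min_(B < [set: G] | leaky_forcing l B) #|B|]|.

Definition resilient l : Prop :=
  leaky_forcing_number 0 = leaky_forcing_number l.

End LeakyForcing.

(* Main.v *)
(** Take the endpoints of the cut [C] as leaks.  A minimum [l]-leaky forcing
    set [B] then forces each side [S] and [~: S] separately, without using any
    edge of [C] and without any force by an endpoint of [C].  On [~: S], replace
    [B] by the vertices that perform no force there: there are equally many,
    they force [~: S] by reversing the forces, and they include all endpoints of
    [C] in [~: S].  One such endpoint can now be left out: once [S] is blue it
    is forced across [C].  This is a zero forcing set smaller than [B]. *)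

Require Import Defs.
From mathcomp Require Import all_boot.

Set Implicit Arguments.
Unset Strict Implicit.
Unset Printing Implicit Defensive.

Lemma superset_of_card (T : finType) (A : {set T}) (n : nat) :
  #|A| <= n <= #|T| -> exists2 L : {set T}, A \subset L & #|L| = n.
Proof.
case/andP=> leAn; rewrite -(subnKC leAn); move: (n - #|A|) => k {n leAn}.
elim: k => [|k IHk] leAT; first by exists A; rewrite ?addn0.
have [|L sAL cardL] := IHk; first by rewrite addnS in leAT; apply: ltnW.
have [x xNL]: exists x, x \notin L.
  have : ~: L != set0 by rewrite -card_gt0 cardsCs setCK subn_gt0 cardL -addnS.
  by case/set0Pn=> x; rewrite inE; exists x.
exists (x |: L); first exact: subset_trans sAL (subsetUr _ _).
by rewrite cardsU1 xNL cardL addnS.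
Qed.

Section Forcing.

Variable G : sgraph.
Implicit Types (L X Y B D S W : {set G}) (u v w : G) (l : nat).

Lemma leaky_forcing_number_le l B :
  leaky_forcing l B -> leaky_forcing_number G l <= #|B|.
Proof.
rewrite /leaky_forcing_number; case: arg_minnP => [|A _ minA]; last exact: minA.
exact: leaky_forcing_setT.
Qed.

Lemma leaky_forcing_number_attained l :
  exists2 B : {set G}, leaky_forcing l B & #|B| = leaky_forcing_number G l.
Proof.
rewrite /leaky_forcing_number; case: arg_minnP => [|B forceB _]; last by exists B.
exact: leaky_forcing_setT.
Qed.

Lemma zero_forcingE B :
  leaky_forcing 0 B = connect (color_change set0) B [set: G].
Proof.
apply/forallP/idP => [/(_ set0)|BT L]; first by rewrite cards0.
by apply/implyP; rewrite cards_eq0 => /eqP ->.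
Qed.

Lemma can_force_adj_blue L X u v w :
  can_force L X u v -> adj u w -> w != v -> w \in X.
Proof.
case/and5P=> _ _ _ _ /forallP/(_ w)/implyP uv uw; apply: contraR => wNX.
by apply: uv; rewrite uw.
Qed.

Lemma can_force_connect X u v :
  can_force set0 X u v -> connect (color_change set0) X (v |: X).
Proof.
by move=> uv; apply/connect1/existsP; exists u; apply/existsP; exists v; rewrite uv /=.
Qed.

(** Induction along the forces in chronological order. [P] may be existential, so an invariant can
    carry a witness that grows with the coloring. *)
Lemma connect_color_change_ind L B (P : {set G} -> Prop) :
    P B ->
    (forall X u v, P X -> can_force L X u v -> P (v |: X)) ->
  forall Y, connect (color_change L) B Y -> P Y.
Proof.
move=> PB stepP Y /connectP[p Bp ->] {Y}.
elim: p B PB Bp => [|X p IHp] B PB //= /andP[/existsP[u /existsP[v]]].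
by case/andP=> uv /eqP->; apply: IHp; apply: stepP PB uv.
Qed.

Lemma connect_set0 L Y : connect (color_change L) set0 Y -> Y = set0.
Proof.
move: Y; apply: connect_color_change_ind => // X u v -> /and5P[].
by rewrite inE.
Qed.

(* Both endpoints of an edge leaving [S] are leaks, so forcing inside [S]
   ignores the colors outside [S], and [D] need not contain [B]. *)
Lemma connect_color_change_closed L S B D Y :
    (forall u w, u \notin L -> adj u w -> (u \in S) = (w \in S)) ->
    B :&: S \subset D -> connect (color_change L) B Y ->
  exists E, [/\ connect (color_change set0) D E, D \subset E
              & Y :&: S \subset E].
Proof.
move=> closedS sBD; move: Y; apply: connect_color_change_ind => [|X u v].
  by exists D; rewrite connect0.
case=> E [DE sDE sXE] uv; have [uX uNL vNX adj_uv _] := and5P uv.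
have [vE|vNE] := boolP ((v \in S) ==> (v \in E)).
  exists E; split=> //; apply/subsetP=> w; rewrite !inE => /andP[].
  case/predU1P=> [-> vS|wX wS]; first exact: implyP vE vS.
  by apply: (subsetP sXE); rewrite inE wX.
rewrite negb_imply in vNE; case/andP: vNE => vS vNE.
have uS : u \in S by rewrite (closedS _ _ uNL adj_uv).
exists (v |: E); split.
- apply: connect_trans DE (can_force_connect (u := u) _).
  apply/and5P; split=> //; rewrite ?inE //.
    by apply: (subsetP sXE); rewrite inE uX.
  (* As [u] is not a leak, all its neighbors lie in [S]; those other than [v] are blue in [X], hence
     also in [E]. *)
  apply/forallP=> w; apply/implyP=> /andP[uw]; apply: contraR => wNv.
  by rewrite (subsetP sXE) // inE (can_force_adj_blue uv) //= -(closedS _ _ uNL uw).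
- exact: subset_trans sDE (subsetUr _ _).
apply/subsetP=> w; rewrite !inE => /andP[/orP[->//|wX] wS].
by rewrite (subsetP sXE) ?orbT // inE wX.
Qed.

(** The case [S = setT] of [connect_color_change_closed]: no edge leaves the whole graph. *)
Lemma connect_color_change_monotone X D :
    X \subset D -> connect (color_change set0) X [set: G] ->
  connect (color_change set0) D [set: G].
Proof.
move=> sXD XT.
have [||E [DE _]] := connect_color_change_closed (S := setT) (D := D) _ _ XT.
- by move=> u w _ _; rewrite !inE.
- by rewrite setIT.
by rewrite setIT subTset => /eqP <-.
Qed.

(* [W] is the set of vertices of [S] that perform a force; reversing those
   forces recolors [W]. *)
Lemma reversed_forcing L S B :
    (forall u w, u \notin L -> adj u w -> (u \in S) = (w \in S)) ->
    connect (color_change L) B [set: G] ->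
  exists W, [/\ W \subset S, [disjoint W & L], #|W| = #|S :\: B|
              & connect (color_change set0) (~: W) [set: G]].
Proof.
move=> closedS BT.
(* The cardinality clause matches each vertex of [S] turned blue so far with its forcer. The clause
   on neighbors records that a vertex that has forced has no white neighbor left. *)
pose P X := exists W, [/\ W \subset S :&: X, [disjoint W & L],
    #|W| = #|(S :&: X) :\: B|, (forall w x, w \in W -> adj w x -> x \in X)
    & B \subset X /\ connect (color_change set0) (~: W) [set: G]].
suff [W [sWS dWL cardW _ [_ WT]]]: P [set: G].
  by exists W; rewrite setIT in sWS cardW.
move: BT; apply: connect_color_change_ind => [|X u v [W [sW dW cardW nbW [sBX WT]]] uv].
  exists set0; rewrite sub0set setC0 connect0 setDE -setIA setICr setI0 cards0.
  by split=> //; [rewrite disjoints_subset sub0set | move=> w x; rewrite inE].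
have [uX uNL vNX adj_uv _] := and5P uv.
have sBvX : B \subset v |: X by apply: subset_trans sBX (subsetUr _ _).
have [vS|vNS] := boolP (v \in S); last first.
  have SvX : S :&: (v |: X) = S :&: X.
    apply/setP=> w; rewrite !inE; case: eqP => // ->.
    by rewrite (negbTE vNS).
  exists W; rewrite SvX; split=> // w x wW /(nbW _ _ wW) xX.
  by rewrite inE xX orbT.
have uNW : u \notin W by apply: contra vNX => /nbW; apply.
have vNW : v \notin W.
  by apply: contra vNX => /(subsetP sW); rewrite inE => /andP[].
have uS : u \in S by rewrite (closedS _ _ uNL adj_uv).
exists (u |: W); split.
- apply/subsetP=> w; rewrite !inE => /predU1P[->|/(subsetP sW)].
    by rewrite uS uX orbT.
  by rewrite inE => /andP[-> ->]; rewrite orbT.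
- by rewrite disjoints_subset subUset sub1set inE uNL -disjoints_subset.
- have -> : (S :&: (v |: X)) :\: B = v |: ((S :&: X) :\: B).
    apply/setP=> w; rewrite !inE; case: eqP => //= ->.
    by rewrite vS (contra (subsetP sBX v)).
  by rewrite !cardsU1 uNW cardW !inE (negbTE vNX) !andbF.
- move=> w x; rewrite !inE => /predU1P[-> ux|wW /(nbW _ _ wW) ->].
    by have [//|/(can_force_adj_blue uv ux)->] := eqVneq x v.
  by rewrite orbT.
split=> //; apply: connect_trans WT.
(* The reversed force: [v] forces [u]. No other neighbor of [v] is white, since a neighbor in [W]
   would make [v] blue in [X]. *)
have -> : ~: W = u |: ~: (u |: W).
  by apply/setP=> w; rewrite !inE; case: eqP => [->|].
apply: (can_force_connect (u := v)); apply/and5P; split.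
- rewrite !inE negb_or vNW andbT; apply: contraNneq vNX => ->; exact: uX.
- by rewrite inE.
- by rewrite !inE eqxx.
- by rewrite adj_sym.
apply/forallP=> w; apply/implyP=> /andP[vw]; rewrite !inE negbK.
case/orP=> // /nbW wW; case/negP: vNX; apply: wW.
by rewrite adj_sym.
Qed.

End Forcing.

Lemma card_cover_edge_induced (G : sgraph) (C : {set {set G}}) (H : sgraph) :
  subgraph (edge_induced C) H -> #|cover C| <= #|H|.
Proof. by case=> f [/leq_card]; rewrite card_sig. Qed.

Theorem theorem3p4 (G : sgraph) (l : nat) :
  resilient G l ->
  ~ exists C : {set {set G}},
      [/\ is_edge_cut C,
          C != set0
        & exists a b : nat,
            a + b <= l /\
            subgraph (edge_induced C) (complete_bipartite a b)].
Proof.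
move=> resG [C [[S [_ _ defC]] /set0Pn[e eC] [a [b [le_ab_l subC]]]]].
have [u0 [v0 [u0S v0NS adj_uv0]]]:
    exists u0 v0, [/\ u0 \in S, v0 \notin S & adj u0 v0].
  move: eC; rewrite defC => /imset2P[u v uS].
  by rewrite !inE => /andP[vNS uv] _; exists u, v.
have coverC u v : u \in S -> v \notin S -> adj u v ->
    (u \in cover C) /\ (v \in cover C).
  move=> uS vNS uv; have uvC : [set u; v] \in C.
    by rewrite defC; apply/imset2P; exists u v; rewrite ?inE ?vNS.
  by split; apply/bigcupP; exists [set u; v]; rewrite ?set21 ?set22.
have le_C_l : #|cover C| <= l.
  apply: leq_trans le_ab_l; apply: leq_trans (card_cover_edge_induced subC) _.
  by rewrite card_sum !card_ord.
have [B forceB cardB] := leaky_forcing_number_attained G l.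
(* If [l] exceeds the order of [G], no set of [l] leaks exists and [set0] is vacuously [l]-leaky
   forcing. Resilience then gives zero forcing number 0, but [set0] forces nothing. *)
have [le_l_G|lt_G_l] := leqP l #|G|; last first.
  have force0 : leaky_forcing l (set0 : {set G}).
    apply/forallP=> L; apply/implyP=> /eqP cardL.
    by move: lt_G_l; rewrite ltnNge -cardL max_card.
  have [B0 forceB0 cardB0] := leaky_forcing_number_attained G 0.
  move: forceB0; rewrite zero_forcingE.
  have -> : B0 = set0.
    apply: cards0_eq; apply/eqP; rewrite cardB0 resG -leqn0.
    by rewrite -[X in _ <= X](cards0 G) leaky_forcing_number_le.
  by move/connect_set0/setP/(_ u0); rewrite !inE.
(* [leaky_forcing] speaks of exactly [l] leaks, so the endpoints of the cut are padded to that
   size. *)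
have [|L sCL cardL] := superset_of_card (A := cover C) (n := l).
  by rewrite le_C_l.
have BT : connect (color_change L) B [set: G].
  by have /forallP/(_ L)/implyP := forceB; apply; apply/eqP.
have closedS u w : u \notin L -> adj u w -> (u \in S) = (w \in S).
  move=> uNL uw; have uNC := contra (subsetP sCL u) uNL.
  have [uS|uNS] := boolP (u \in S); have [wS|wNS] := boolP (w \in S) => //.
    by case: (coverC _ _ uS wNS uw) => uC; rewrite uC in uNC.
  by move: uw; rewrite adj_sym => /(coverC _ _ wS uNS)[_ uC]; rewrite uC in uNC.
have closedSC u w : u \notin L -> adj u w -> (u \in ~: S) = (w \in ~: S).
  by move=> uNL uw; rewrite !inE (closedS _ _ uNL uw).
have [W [sWSC dWL cardW WT]] := reversed_forcing closedSC BT.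
have crossNW w : w \notin S -> adj u0 w -> w \notin W.
  move=> wNS u0w; have [_ wC] := coverC _ _ u0S wNS u0w.
  by apply: contraTN (subsetP sCL _ wC) => wW; rewrite (disjointFr dWL).
(* The first part forces [S] on its own; the second is the set of non-forcers of the other side,
   without the leak [v0]. *)
pose F := (B :&: S) :|: ((~: S :\: W) :\ v0).
have [|E [FE sFE sSE]] := connect_color_change_closed (D := F) closedS _ BT.
  exact: subsetUl.
rewrite setTI in sSE.
have inE_E w : w \notin W -> w != v0 -> w \in E.
  move=> wNW wNv0; have [/(subsetP sSE)//|wNS] := boolP (w \in S).
  by apply: (subsetP sFE); rewrite !inE wNv0 wNW wNS orbT.
have zfF : leaky_forcing 0 F.
  rewrite zero_forcingE; apply: connect_trans FE _.
  have sWE : ~: W \subset v0 |: E.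
    apply/subsetP=> w; rewrite !inE => wNW.
    by have [//|/(inE_E _ wNW)] := eqVneq w v0.
  apply: connect_trans (connect_color_change_monotone sWE WT).
  (* If [v0] is still white, [u0] forces it: the other neighbors of [u0] lie in [S] or are cut
     endpoints, which are outside [W] and so already in [E]. *)
  have [v0E|v0NE] := boolP (v0 \in E).
    by rewrite (setUidPr _) ?sub1set ?connect0.
  apply: (can_force_connect (u := u0)); apply/and5P; split=> //.
  - exact: (subsetP sSE).
  - by rewrite inE.
  apply/forallP=> w; apply/implyP=> /andP[u0w]; apply: contraR => wNv0.
  have [/(subsetP sSE)//|wNS] := boolP (w \in S).
  exact: inE_E (crossNW _ wNS u0w) wNv0.
have := leaky_forcing_number_le zfF; rewrite resG -cardB leqNgt => /negP[].
have cardSC : #|~: S :\: W| = #|B :\: S|.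
  have -> : B :\: S = ~: S :&: B by rewrite setDE setIC.
  (* After adding the size of [W], which is that of [~: S :\: B], both sides count [~: S]. *)
  apply/eqP; rewrite -(eqn_add2r #|W|) [X in _ == _ + X]cardW cardsID.
  by rewrite -[X in _ == X](cardsID W) (setIidPr sWSC) addnC.
have v0SC : v0 \in ~: S :\: W by rewrite !inE v0NS crossNW.
rewrite -[X in _ < X](cardsID S) -cardSC (cardsD1 v0 (_ :\: W)) v0SC.
by rewrite add1n addnS ltnS cardsU leq_subr.
Qed.
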